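(* Let $G$ be a connected graph and $v\in V(G)$. Then $$\chi_d^t(G)-2\leq \chi_d^t(G/v)\leq \chi_d^t(G)+\deg(v)-1.$$
   Context: All graphs are simple and finite. For a graph with no isolated vertex, a total dominator coloring (TD-coloring) is a proper vertex coloring in which every vertex is adjacent to every vertex of some color class (a class other than its own); $\chi_d^t$ denotes the minimum number of colors in such a coloring. The vertex contraction $G/v$ is the graph obtained from $G$ by deleting $v$ and making the open neighbourhood of $v$ a clique (pairs of neighbours already adjacent stay simply adjacent). Implicitly, every graph whose $\chi_d^t$ appears has no isolated vertex. *)

(* Defs.v *)
From mathcomp Require Import all_boot.

Set Implicit Arguments.
Unset Strict Implicit.
Unset Printing Implicit Defensive.

Record sgraph := SGraph {
  vertex :> finType;
  adj : rel vertex;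
  adj_sym : symmetric adj;
  adj_irrefl : irreflexive adj }.

Definition nbhd (G : sgraph) (x : G) : {set G} := [set y | adj x y].

Definition deg (G : sgraph) (x : G) : nat := #|nbhd x|.

Definition no_isolated (G : sgraph) : Prop := forall x : G, nbhd x != set0.

Definition connected_graph (G : sgraph) : Prop :=
  0 < #|G| /\ forall x y : G, connect (@adj G) x y.

Section Contraction.
Variables (G : sgraph) (v : G).

Definition contract_adj : rel {x : G | x != v} := fun x y =>
  adj (val x) (val y) ||
  [&& x != y, val x \in nbhd v & val y \in nbhd v].

Lemma contract_adj_sym : symmetric contract_adj.
Proof.
by move=> x y; rewrite /contract_adj adj_sym eq_sym (andbC (val x \in _)).
Qed.

Lemma contract_adj_irrefl : irreflexive contract_adj.
Proof. by move=> x; rewrite /contract_adj adj_irrefl eqxx. Qed.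

Definition contract : sgraph := SGraph contract_adj_sym contract_adj_irrefl.

End Contraction.

Section TDColoring.
Variable G : sgraph.

Definition color_class k (c : {ffun G -> 'I_k}) (i : 'I_k) : {set G} :=
  [set x | c x == i].

Definition proper_coloring k (c : {ffun G -> 'I_k}) : bool :=
  [forall x, forall y, adj x y ==> (c x != c y)].

(* All k colors must be used: an empty class would be dominated vacuously
   by every vertex. *)
Definition td_coloring k (c : {ffun G -> 'I_k}) : bool :=
  [&& [forall i, color_class c i != set0],
      proper_coloring c &
      [forall x, exists i,
         (i != c x) && [forall y in color_class c i, adj x y]]].

Definition td_colorable : pred nat := fun k =>
  [exists c : {ffun G -> 'I_k}, td_coloring c].

Lemma td_colorable_ex : no_isolated G -> exists k, td_colorable k.
Proof.
move=> noisoG; exists #|G|; apply/existsP; exists [ffun x => enum_rank x].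
apply/and3P; split.
- apply/forallP=> i; apply/set0Pn; exists (enum_val i).
  by rewrite inE ffunE enum_valK.
- apply/forallP=> x; apply/forallP=> y; apply/implyP=> xy.
  rewrite !ffunE (inj_eq enum_rank_inj).
  by apply: contraTneq xy => ->; rewrite adj_irrefl.
- apply/forallP=> x; have /set0Pn[y] := noisoG x; rewrite inE => xy.
  apply/existsP; exists (enum_rank y); apply/andP; split.
    rewrite ffunE (inj_eq enum_rank_inj).
    by apply: contraTneq xy => ->; rewrite adj_irrefl.
  apply/forall_inP=> z.
  by rewrite inE ffunE (inj_eq enum_rank_inj) => /eqP->.
Qed.

Definition td_chromatic (noisoG : no_isolated G) : nat :=
  ex_minn (td_colorable_ex noisoG).

End TDColoring.

(* Main.v *)
Require Import Defs.
From mathcomp Require Import all_boot.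

(** Lower bound: extend an optimal coloring of [G/v] by two fresh singleton
    classes, [{v}] and [{w}] for some neighbor [w] of [v]; the neighbors of [v]
    then dominate [{v}], and [v] dominates [{w}].

    Upper bound: in an optimal coloring of [G], give each neighbor of [v] its
    own fresh color. The class dominated by [v] disappears, so at most
    [deg v - 1] colors are added. Domination can only fail at a neighbor [x] of
    [v] that relied on [{v}] being a class: [x] dominates another neighbor of
    [v] if there is one; otherwise a neighbor of [x] in [G/v] also receives a
    fresh color, which is paid for by the lost class [{v}]. *)

(** Counting only the colors in the image makes every class nonempty, so any finite color type will
    do. The representative [y] excludes vacuous domination, and irreflexivity of [adj] keeps its
    class distinct from that of [x]. *)
Lemma td_chromatic_le (G : sgraph) (noisoG : no_isolated G) (T : finType)
    (f : G -> T) :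
  (forall x y : G, adj x y -> f x != f y) ->
  (forall x : G, exists y, forall z, f z = f y -> adj x z) ->
  td_chromatic noisoG <= #|f @: [set: G]|.
Proof.
move=> f_proper f_dom; set A := f @: [set: G].
have fA x : f x \in A by apply: imset_f.
pose c := [ffun x => enum_rank_in (fA x) (f x)].
have cE x y : (c x == c y) = (f x == f y).
  apply/eqP/eqP => [/(congr1 enum_val)|fxy].
    by rewrite !ffunE !enum_rankK_in.
  by apply: enum_val_inj; rewrite !ffunE !enum_rankK_in.
rewrite /td_chromatic; case: ex_minnP => m _; apply.
apply/existsP; exists c; apply/and3P; split.
- apply/forallP=> i; have /imsetP[x _ fx] := enum_valP i.
  apply/set0Pn; exists x; rewrite inE ffunE.
  by apply/eqP/enum_val_inj; rewrite enum_rankK_in.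
- apply/forallP=> x; apply/forallP=> y; apply/implyP=> xy.
  by rewrite cE f_proper.
apply/forallP=> x; have [y domy] := f_dom x.
apply/existsP; exists (c y); apply/andP; split.
  rewrite cE; apply/eqP => fyx.
  by have := domy x (esym fyx); rewrite adj_irrefl.
by apply/forall_inP=> z; rewrite inE cE => /eqP/domy.
Qed.

Lemma td_chromatic_coloring (G : sgraph) (noisoG : no_isolated G) :
  exists c : G -> 'I_(td_chromatic noisoG),
    (forall x y : G, adj x y -> c x != c y) /\
    (forall x : G, exists y, forall z, c z = c y -> adj x z).
Proof.
rewrite /td_chromatic; case: ex_minnP => m /existsP[c /and3P[c_surj c_proper c_dom]] _.
exists c; split=> [x y xy|x].
  by move/forallP/(_ x)/forallP/(_ y)/implyP: c_proper; apply.
have /existsP[i /andP[_ /forall_inP domi]] := forallP c_dom x.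
have /set0Pn[y] := forallP c_surj i; rewrite inE => /eqP cy.
by exists y => z cz; apply: domi; rewrite inE cz cy.
Qed.

Lemma td_chromatic_le_contract (G : sgraph) (v : G)
    (noisoG : no_isolated G) (noisoGv : no_isolated (contract v)) :
  td_chromatic noisoG <= td_chromatic noisoGv + 2.
Proof.
have [c [c_proper c_dom]] := td_chromatic_coloring _ noisoGv.
have /set0Pn[w] := noisoG v; rewrite inE => vw.
have wNv : w != v by apply: contraTneq vw => ->; rewrite adj_irrefl.
(* [insub] fails only at [v], so [inl true] and [inl false] are private to [w] and [v]. *)
pose f (x : G) : bool + 'I_(td_chromatic noisoGv) :=
  if x == w then inl true else
  if insub x is Some u then inr (c u) else inl false.
have fw : f w = inl true by rewrite /f eqxx.
have fv : f v = inl false.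
  by rewrite /f eq_sym (negPf wNv) insubF ?eqxx.
have fE (u : contract v) : val u != w -> f (val u) = inr (c u).
  by move=> uNw; rewrite /f (negPf uNw) valK.
have f_inv x : [\/ x = w, x = v |
    exists u : contract v, [/\ x = val u, val u != w & f x = inr (c u)]].
  have [->|xNw] := eqVneq x w; first by apply: Or31.
  have [->|xNv] := eqVneq x v; first by apply: Or32.
  by apply: Or33; exists (Sub x xNv); rewrite -fE.
have f_w z : f z = inl true -> z = w.
  by case: (f_inv z) => [//|->|[u [_ _ ->]]]; rewrite ?fv.
have f_v z : f z = inl false -> z = v.
  by case: (f_inv z) => [->|//|[u [_ _ ->]]]; rewrite ?fw.
have le_card : #|f @: [set: G]| <= td_chromatic noisoGv + 2.
  apply: leq_trans (max_card _) _.
  by rewrite card_sum card_bool card_ord addnC.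
apply: leq_trans le_card; apply: td_chromatic_le => [x y xy|x].
  have xNy : x != y by apply: contraTneq xy => ->; rewrite adj_irrefl.
  case: (f_inv x) (f_inv y) => [xE|xE|[a [xE _ fx]]] [yE|yE|[b [yE _ fy]]];
    rewrite ?xE ?yE ?fv ?fw // ?fx ?fy //; subst; rewrite ?eqxx // in xNy *.
  - by rewrite fy.
  - by rewrite fy.
  - by rewrite fx.
  - by rewrite fx.
  - rewrite fx fy; apply: contraNneq (c_proper a b _) => [[->]//|].
    by rewrite /= /contract_adj xy.
have [xv|xNv] := boolP (adj x v).
  by exists v => z; rewrite fv => /f_v->.
have [->|x_v] := eqVneq x v.
  by exists w => z; rewrite fw => /f_w->.
pose x' : contract v := Sub x x_v.
have [y domy] := c_dom x'.
(* As [x] is not a neighbor of [v], contraction adds no edge at [x]. *)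
have domG (z : contract v) : c z = c y -> adj x (val z).
  move/domy; rewrite /= /contract_adj => /orP[//|/and3P[_]].
  by rewrite inE adj_sym (negPf xNv).
(* Recoloring can only remove [w] from the dominated class; if [w] is its representative, the new
   class of [w] alone takes over. *)
have [yw|yNw] := eqVneq (val y) w.
  by exists w => z; rewrite fw => /f_w->; rewrite -yw; apply: domG.
exists (val y) => z; rewrite (fE _ yNw).
case: (f_inv z) => [->|->|[u [-> _ ->]]]; rewrite ?fv ?fw // => -[].
exact: domG.
Qed.

(** Each vertex of [S] becomes a singleton class and the others keep their old colors. Since [S]
    contains the neighbors of [v], the added clique is properly colored. The last hypothesis repairs
    domination at neighbors of [v] when [v] alone formed a class. *)
Lemma td_chromatic_contract_le_recolor (G : sgraph) (v : G)
    (noisoGv : no_isolated (contract v)) (T : finType) (c : G -> T)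
    (S : {set G}) :
  (forall x y : G, adj x y -> c x != c y) ->
  (forall x : G, exists y, forall z, c z = c y -> adj x z) ->
  nbhd v \subset S -> v \notin S ->
  (forall x, adj v x -> (forall z, c z = c v -> z = v) ->
     exists2 y, y \in S & adj x y || (y != x) && adj v y) ->
  td_chromatic noisoGv <= #|S| + #|c @: ~: (v |: S)|.
Proof.
move=> c_proper c_dom /subsetP NS vNS domN.
pose f (u : contract v) : G + T :=
  if val u \in S then inl (val u) else inr (c (val u)).
have le_card : #|f @: setT| <= #|S| + #|c @: ~: (v |: S)|.
  rewrite -(card_imset S (@inl_inj G T)).
  rewrite -(card_imset (c @: ~: (v |: S)) (@inr_inj G T)).
  apply: leq_trans (leq_card_setU _ _); apply/subset_leq_card/subsetP=> t.
  case/imsetP=> u _ ->; rewrite /f inE; case: ifPn => uS.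
    by rewrite imset_f.
  by apply/orP; right; rewrite !imset_f // !inE negb_or (valP u) uS.
have f_dom_S (x u : contract v) : val u \in S -> adj x u ->
    forall z, f z = f u -> adj x z.
  move=> uS xu z; rewrite /f uS; case: ifP => // _ [zu].
  by rewrite (val_inj zu).
apply: leq_trans le_card; apply: td_chromatic_le => [x y|x].
  rewrite /= /contract_adj => /orP[xy|/and3P[xNy xN yN]].
    have xNy : val x != val y by apply: contraTneq xy => ->; rewrite adj_irrefl.
    rewrite /f; case: ifP => _; case: ifP => _ //.
    apply: contraNneq (c_proper _ _ xy) => [[->]//].
  by rewrite /f !NS.
have [y domy] := c_dom (val x).
(* The old class dominated by [x] either meets [S], giving a singleton to dominate, or survives up
   to the removal of [v], or consists of [v] alone. *)
have [/existsP[u /andP[uS /eqP cu]]|/existsPn noS] :=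
    boolP [exists u : contract v, (val u \in S) && (c (val u) == c y)].
  exists u; apply: f_dom_S => //.
  by rewrite /= /contract_adj domy.
have [/existsP[u /eqP cu]|/existsPn noC] :=
    boolP [exists u : contract v, c (val u) == c y].
  exists u => z; rewrite {2}/f.
  have := noS u; rewrite cu eqxx andbT => /negPf->.
  rewrite /f; case: ifP => // _ [cz].
  by rewrite /= /contract_adj domy // cz.
have class_v z : c z = c y -> z = v.
  move=> cz; apply/eqP; apply: contraT => zNv.
  by have := noC (Sub z zNv); rewrite /= cz eqxx.
have yv := class_v y erefl.
have vx : adj v (val x) by rewrite adj_sym; apply: domy; rewrite yv.
have [|u uS xu] := domN _ vx.
  by move=> z; rewrite -{1}yv; apply: class_v.
have uNv : u != v by apply: contraNneq vNS => <-.
exists (Sub u uNv : contract v); apply: f_dom_S => //.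
rewrite /= /contract_adj !inE vx /=.
by case/orP: xu => [->//|/andP[uNx ->]]; rewrite -val_eqE /= eq_sym uNx orbT.
Qed.

Lemma td_chromatic_contract_le (G : sgraph) (v : G)
    (noisoG : no_isolated G) (noisoGv : no_isolated (contract v)) :
  td_chromatic noisoGv <= td_chromatic noisoG + deg v - 1.
Proof.
have [c [c_proper c_dom]] := td_chromatic_coloring _ noisoG.
have vN : v \notin nbhd v by rewrite inE adj_irrefl.
have [w domw] := c_dom v.
(* The class dominated by [v] lies inside its neighborhood, so it is entirely recolored. *)
have lost_w (S : {set G}) : nbhd v \subset S -> c w \notin c @: ~: (v |: S).
  move=> /subsetP NS; apply/negP => /imsetP[z]; rewrite !inE negb_or.
  case/andP=> _ /negP zS cz; apply: zS; apply: NS.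
  by rewrite inE; apply: domw.
have recolor_N : (forall x, adj v x -> (forall z, c z = c v -> z = v) ->
    exists2 y, y \in nbhd v & adj x y || (y != x) && adj v y) ->
    td_chromatic noisoGv <= td_chromatic noisoG + deg v - 1.
  move=> domN; have := td_chromatic_contract_le_recolor _ _ noisoGv _ _ _
    c_proper c_dom (subxx _) vN domN.
  move=> /leq_trans; apply; rewrite addnC -/(deg v).
  have : #|c @: ~: (v |: nbhd v)| < td_chromatic noisoG.
    rewrite -[X in _ < X]card_ord -cardsT; apply: proper_card.
    apply/properP; split; first exact: subsetT.
    by exists (c w); rewrite ?inE // lost_w.
  (* The strict bound rules out zero colors, where the truncated subtraction would matter. *)
  move: (td_chromatic noisoG) #|c @: _| => [|k] m; first by rewrite ltn0.
  by rewrite ltnS addSn subn1 leq_add2r.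
(* If [v] shares its color, no neighbor relies on it alone and [domN] is vacuous. *)
have [/existsP[z /andP[zNv /eqP cz]]|/existsPn class_v] :=
    boolP [exists z, (z != v) && (c z == c v)].
  by apply: recolor_N => x _ /(_ z cz) zv; rewrite zv eqxx in zNv.
have [deg_gt1|deg_le1] := ltnP 1 (deg v).
  apply: recolor_N => x vx _.
  have /card_gt0P[y] : 0 < #|nbhd v :\ x|.
    by move: deg_gt1; rewrite /deg (cardsD1 x) inE vx.
  rewrite !inE => /andP[yNx vy].
  by exists y; rewrite ?inE ?yNx ?vy ?orbT.
have vw : adj v w by apply: domw.
have Nw : nbhd v = [set w].
  by apply/esym/eqP; rewrite eqEcard sub1set inE vw cards1.
have wNv : w != v by apply: contraTneq vw => ->; rewrite adj_irrefl.
(* With [w] the only neighbor of [v], contraction adds no edges, so [y] is already a neighbor of [w]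
   in [G]. *)
have /set0Pn[y] := noisoGv (Sub w wNv).
rewrite inE /= /contract_adj /= Nw !inE -val_eqE /= eqxx /=.
rewrite eq_sym andNb orbF => wy.
pose S := val y |: nbhd v.
have NS : nbhd v \subset S by apply: subsetUr.
have vNS : v \notin S by rewrite !inE negb_or eq_sym (valP y) adj_irrefl.
have domS x : adj v x -> (forall z, c z = c v -> z = v) ->
    exists2 y, y \in S & adj x y || (y != x) && adj v y.
  move=> vx _; exists (val y); first by rewrite !inE eqxx.
  have : x \in nbhd v by rewrite inE.
  by rewrite Nw inE => /eqP->; rewrite wy.
have := td_chromatic_contract_le_recolor _ _ noisoGv _ _ _
    c_proper c_dom NS vNS domS.
move=> /leq_trans; apply.
have lost_v : c v \notin c @: ~: (v |: S).
  apply/negP => /imsetP[z]; rewrite !inE negb_or => /andP[zNv _] cz.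
  by have := class_v z; rewrite zNv cz eqxx.
(* The two lost colors, distinct because [v] and [w] are adjacent, pay for the at most two fresh
   ones on [S]. *)
have card_cvw : #|[set c v; c w]| = 2 by rewrite cards2 c_proper.
have sub_img : (c @: ~: (v |: S)) \subset ~: [set c v; c w].
  apply/subsetP=> i ci; rewrite !inE negb_or.
  by apply/andP; split; apply: contraTneq ci => ->; rewrite // lost_w.
have cardS : #|S| <= 2 by rewrite /S Nw cards2; case: (_ != _).
rewrite /deg Nw cards1 addnK.
rewrite -[X in _ <= X]card_ord -(cardsC [set c v; c w]) card_cvw.
exact: leq_add cardS (subset_leq_card sub_img).
Qed.

Theorem theorem3p3 (G : sgraph) (v : G)
    (connG : connected_graph G)
    (noisoG : no_isolated G) (noisoGv : no_isolated (contract v)) :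
  td_chromatic noisoG - 2 <= td_chromatic noisoGv
    <= td_chromatic noisoG + deg v - 1.
Proof.
by rewrite td_chromatic_contract_le andbT leq_subLR addnC td_chromatic_le_contract.
Qed.
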